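(* Let $k=3$, $\alpha\in(0,1)$, $\sigma\geqslant0$, $\tau>0$, and let $q_j^k$, $j\geqslant0$, be the real numbers defined in the context. Then for any positive integer $N$ and any $v^1,\dots,v^N\in H$, $$\sum_{n=1}^N\Big(\sum_{j=0}^{n-1}q_j^k\,v^{n-j},\,v^n\Big)\geqslant 0$$ (if the scalars are complex, the left-hand side is replaced by its real part).
   Context: $(H,(\cdot,\cdot))$ is a Hilbert space. With $k=3$, the real numbers $g_j^k$ are defined by the power series expansion at $\zeta=0$ $$\Big(\sum_{j=1}^{k}\frac1j\,(1-e^{-\sigma\tau}\zeta)^j\Big)^\alpha=\sum_{j=0}^\infty g_j^k\,\zeta^j,$$ where the branch of the power is the one that is positive at $\zeta=0$, and $$q_j^k=\sum_{m=0}^j\frac1{2^m}\,e^{-\sigma m\tau}\,g_{j-m}^k ,\qquad j\geqslant 0.$$ Equivalently, $\sum_{j\ge0}q_j^k\zeta^j$ is the power series at $\zeta=0$ of the function $\Big(\sum_{j=1}^{3}\frac1j\,(1-e^{-\sigma\tau}\zeta)^j\Big)^\alpha$ divided by $1-\frac12e^{-\sigma\tau}\zeta$. *)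

(* Defs.v *)
From HB Require Import structures.
From mathcomp Require Import all_boot all_order all_algebra complex.
From mathcomp Require Import all_classical all_reals all_analysis.
Set Implicit Arguments.
Unset Strict Implicit.
Unset Printing Implicit Defensive.
Import Order.TTheory GRing.Theory Num.Theory.
Import numFieldNormedType.Exports.
Local Open Scope classical_set_scope.
Local Open Scope ring_scope.

(* A Hilbert space over K is a complete normed module over K together with a
   positive definite form inducing its norm.  The form is linear in its first
   argument and theta-semilinear in its second one; theta is the identity for
   real scalars and the complex conjugation for complex scalars. *)
Definition induces_norm (K : numFieldType) (theta : K -> K)
    (H : completeNormedModType K) (dot : {dot H for theta}) : Prop :=
  forall v : H, dot v v = `|v| ^+ 2.

(* The expansion is along the real line, which already determines the real
   coefficients a. *)
Definition has_pseries_at0 (R : realType) (f : R -> R) (a : R ^nat) : Prop :=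
  \forall x \near (0 : R), pseries a x @ \oo --> f x.

(* The base of the power is positive at x = 0, hence for x near 0, where powR is
   therefore the branch that is positive at 0. *)
Definition gfun (R : realType) (k : nat) (alpha sigma tau : R) (x : R) : R :=
  (\sum_(1 <= j < k.+1) j%:R^-1 * (1 - expR (- (sigma * tau)) * x) ^+ j)
    `^ alpha.

Definition qcoef (R : realType) (sigma tau : R) (g : R ^nat) (j : nat) : R :=
  \sum_(0 <= m < j.+1)
     (2 ^+ m)^-1 * expR (- (sigma * m%:R * tau)) * g (j - m)%N.

(* Main.v *)
(* Up to a positive factor and the dilation z -> exp(- sigma tau) z, the series
   of the q_j is u^alpha w with w = 1 / (1 - z / 2) and u = delta / delta(0),
   delta(z) = (1 - z) + (1 - z)^2 / 2 + (1 - z)^3 / 3.  Call a series positive if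
   all its truncated Toeplitz forms are nonnegative.  The series w and u w are
   positive, by explicit sums of squares.  Positive series are closed under sums,
   inverses and dilations by r <= 1, hence under the arithmetic-harmonic mean
   iteration, which converges z-adically to the geometric mean.  So the set of
   alpha for which u^alpha w is positive is closed under midpoints and contains
   0 and 1, and the coefficients of u^alpha are polynomials in alpha. *)
Require Import Defs.
From HB Require Import structures.
From mathcomp Require Import all_boot all_order all_algebra complex.
From mathcomp Require Import all_classical all_reals all_analysis.
From mathcomp Require Import ring lra.
Import Order.TTheory GRing.Theory Num.Theory.
Import numFieldNormedType.Exports.
Local Open Scope ring_scope.
Local Open Scope complex_scope.

(** * Formal power series and their convolution action on sequences of vectors *)

Definition fps (R : fieldType) : Type := nat -> R.
HB.instance Definition _ (R : fieldType) := GRing.Zmodule.copy (fps R) (nat -> R).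

Definition conv {R : fieldType} {V : lmodType R} (a : fps R) (v : nat -> V)
  (n : nat) : V := \sum_(j < n.+1) a j *: v (n - j)%N.


Section Conv.
Context {R : fieldType} {V : lmodType R}.
Implicit Types (a b : fps R) (v : nat -> V).

Lemma conv0 a v : conv a v 0%N = a 0%N *: v 0%N.
Proof. by rewrite /conv big_ord1 subnn. Qed.

Lemma convS a v n :
  conv a v n.+1 = a 0%N *: v n.+1 + conv (fun j => a j.+1 : R) v n.
Proof. by rewrite /conv big_ord_recl subn0; congr (_ + _); apply: eq_bigr. Qed.

Lemma eq_conv a b v n :
  (forall j, (j <= n)%N -> a j = b j) -> conv a v n = conv b v n.
Proof. by move=> ab; apply: eq_bigr => j _; rewrite ab // -ltnS. Qed.

Lemma convDl a b v n : conv (a + b) v n = conv a v n + conv b v n.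
Proof. by rewrite -big_split /=; apply: eq_bigr => j _; rewrite scalerDl. Qed.

Lemma convZl (c : R) a v n : conv (fun j => c * a j : R) v n = c *: conv a v n.
Proof. by rewrite scaler_sumr; apply: eq_bigr => j _; rewrite scalerA. Qed.

End Conv.

Section FpsRing.
Context {R : fieldType}.
Implicit Types (a b c : fps R).

Definition fps_mul a b : fps R := fun n => \sum_(j < n.+1) a j * b (n - j)%N.
Definition fps_one : fps R := fun n => (n == 0%N)%:R.

Lemma fps_mul0 a b : fps_mul a b 0%N = a 0%N * b 0%N.
Proof. by rewrite /fps_mul big_ord1 subnn. Qed.

Lemma fps_mulS a b n :
  fps_mul a b n.+1 = a 0%N * b n.+1 + fps_mul (fun j => a j.+1 : R) b n.
Proof. by rewrite /fps_mul big_ord_recl subn0; congr (_ + _); apply: eq_bigr. Qed.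

(** Makes vector sequences a module over series; at [V := R^o] it is also the associativity of the
    product. *)
Lemma conv_mul {V : lmodType R} a b (v : nat -> V) n :
  conv (fps_mul a b) v n = conv a (conv b v) n.
Proof.
elim: n a b => [|n IHn] a b; first by rewrite !conv0 fps_mul0 scalerA.
rewrite [LHS]convS [RHS]convS fps_mul0 -scalerA.
transitivity (a 0%N *: (b 0%N *: v n.+1) +
  conv ((fun j => a 0%N * b j.+1 : R) + fps_mul (fun j => a j.+1) b : fps R) v n).
  by congr (_ + _); apply: eq_conv => j _; rewrite fps_mulS.
by rewrite convDl convZl IHn [conv b v n.+1]convS scalerDr addrA.
Qed.

Fact fps_mulA : associative fps_mul.
Proof. by move=> a b c; apply/funext => n; rewrite [RHS](@conv_mul R^o). Qed.
Fact fps_mulC : commutative fps_mul.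
Proof.
move=> a b; apply/funext => n; rewrite /fps_mul.
rewrite (reindex_inj rev_ord_inj) /=; apply: eq_bigr => j _.
by rewrite subSS subKn 1?mulrC // -ltnS.
Qed.
Fact fps_mul1 : left_id fps_one fps_mul.
Proof.
move=> a; apply/funext => n; rewrite /fps_mul big_ord_recl /= subn0.
by rewrite mul1r big1 ?addr0 // => j _; rewrite mul0r.
Qed.
Fact fps_mulDl : left_distributive fps_mul +%R.
Proof.
move=> a b c; apply/funext => n; rewrite [RHS]/GRing.add /= /fps_mul -big_split.
by apply: eq_bigr => j _; exact: mulrDl.
Qed.
Fact fps_one_neq0 : fps_one != 0 :> fps R.
Proof. by apply/eqP => /(congr1 (@^~ 0%N))/eqP; rewrite oner_eq0. Qed.

HB.instance Definition _ := GRing.Zmodule_isComNzRing.Build (fps R)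
  fps_mulA fps_mulC fps_mul1 fps_mulDl fps_one_neq0.
End FpsRing.


(** * Constants, divisibility by powers of z, inverses and formal derivative *)

Section FpsTheory.
Context {R : fieldType}.
Implicit Types (a b c : fps R) (n : nat).

Lemma fpsME a b n : (a * b) n = \sum_(j < n.+1) a j * b (n - j)%N.
Proof. by []. Qed.

Lemma fpsM0 a b : (a * b) 0%N = a 0%N * b 0%N.
Proof. exact: fps_mul0. Qed.

Lemma convM {V : lmodType R} a b (v : nat -> V) n :
  conv (a * b) v n = conv a (conv b v) n.
Proof. exact: conv_mul. Qed.

Lemma conv1 {V : lmodType R} (v : nat -> V) n : conv (1 : fps R) v n = v n.
Proof.
rewrite /conv big_ord_recl /= subn0 scale1r big1 ?addr0 // => j _.
by rewrite scale0r.
Qed.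

Definition fpsC (c : R) : fps R := fun n => c * (n == 0%N)%:R.

Lemma fpsCM (c : R) a n : (fpsC c * a) n = c * a n.
Proof.
rewrite fpsME big_ord_recl /= subn0 /fpsC mulr1 big1 ?addr0 // => j _.
by rewrite mulr0 mul0r.
Qed.

Lemma fpsCD (c d : R) : fpsC (c + d) = fpsC c + fpsC d.
Proof. by apply/funext => n; rewrite /fpsC mulrDl. Qed.

Lemma fpsC_mul (c d : R) : fpsC (c * d) = fpsC c * fpsC d.
Proof. by apply/funext => n; rewrite fpsCM /fpsC mulrA. Qed.

Lemma fpsC1 : fpsC 1 = 1.
Proof. by apply/funext => n; rewrite /fpsC mul1r. Qed.

(** Divisibility by z^m, the measure of z-adic closeness. *)
Definition vanishes (m : nat) a := forall i, (i < m)%N -> a i = 0.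

Lemma vanishesM {m k a b} :
  vanishes m a -> vanishes k b -> vanishes (m + k) (a * b).
Proof.
move=> am bk i ik; rewrite fpsME big1 // => j _.
have [jm|mj] := ltnP j m; first by rewrite am ?mul0r.
by rewrite bk ?mulr0 // ltn_subLR ?(leq_trans ik) ?leq_add2r // -ltnS.
Qed.

(** Course-of-values recursion: [L n] is a table that is correct below [n], and [F n] reads only
    that part of it. *)
Lemma strong_recursion {T : Type} (x0 : T) (F : nat -> (nat -> T) -> T) :
  (forall n s t, (forall j, (j < n)%N -> s j = t j) -> F n s = F n t) ->
  exists s, forall n, s n = F n s.
Proof.
move=> Fext; pose fix L n : nat -> T :=
  if n is m.+1 then fun j => if j == m then F m (L m) else L m j else fun=> x0.
have LE n j : (j < n)%N -> L n j = L j.+1 j.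
  elim: n => // n IHn; rewrite ltnS leq_eqVlt => /orP[/eqP -> //|jn].
  by rewrite -IHn //= ltn_eqF.
exists (fun n => L n.+1 n) => n; rewrite /= eqxx.
by apply: Fext => j /LE ->; rewrite /= eqxx.
Qed.

Lemma fps_inv a : a 0%N != 0 -> exists b, a * b = 1.
Proof.
move=> a0; have [|b bE] := @strong_recursion R 0 (fun n s =>
  (a 0%N)^-1 * ((n == 0%N)%:R - \sum_(j < n) a j.+1 * s (n - j.+1)%N)).
  move=> n s t st; congr (_ * (_ - _)); apply: eq_bigr => j _.
  by rewrite st // ltn_subrL /= (leq_ltn_trans _ (ltn_ord j)).
exists b; apply/funext => n; rewrite fpsME big_ord_recl subn0 bE mulVKf //.
by rewrite subrK.
Qed.

Definition fpsD a : fps R := fun n => n.+1%:R * a n.+1.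

Lemma fpsDM a b : fpsD (a * b) = fpsD a * b + a * fpsD b.
Proof.
apply/funext => n; rewrite /fpsD fpsME mulr_sumr.
rewrite [RHS]/GRing.add /= !fpsME.
transitivity (\sum_(j < n.+2) j%:R * a j * b (n.+1 - j)%N +
              \sum_(j < n.+2) a j * ((n.+1 - j)%:R * b (n.+1 - j)%N)).
  rewrite -big_split; apply: eq_bigr => j _ /=.
  have -> : n.+1%:R = j%:R + (n.+1 - j)%:R :> R by rewrite -natrD subnKC // -ltnS.
  by ring.
congr (_ + _).
  by rewrite big_ord_recl /= !mul0r add0r.
rewrite big_ord_recr /= subnn mul0r mulr0 addr0; apply: eq_bigr => j _ /=.
by rewrite subSn // -ltnS.
Qed.

Lemma fpsDC (c : R) : fpsD (fpsC c) = 0.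
Proof. by apply/funext => n; rewrite /fpsD /fpsC !mulr0. Qed.

End FpsTheory.

(** * Powers of a series with arbitrary real exponent *)

Section FpsPower.
Context {R : realFieldType}.
Implicit Types (u a b : fps R) (x y : R).

(* For u with constant term 1, this differential equation determines u^x. *)
Definition is_fps_power u x a :=
  a 0%N = 1 /\ u * fpsD a = fpsC x * (fpsD u * a).

(** Compare the coefficients of z^n in u a' = x u' a. Since u has constant term 1, a_(n+1) occurs
    with the factor n+1 and can be solved for. *)
Lemma fps_power_recursion u x a : u 0%N = 1 ->
  is_fps_power u x a <-> a 0%N = 1 /\ forall n, a n.+1 = n.+1%:R^-1 *
    (x * \sum_(j < n.+1) fpsD u j * a (n - j)%N -
     \sum_(j < n) u j.+1 * (n - j.+1).+1%:R * a (n - j.+1).+1).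
Proof.
move=> u1; have LE n : (u * fpsD a) n = n.+1%:R * a n.+1 +
    \sum_(j < n) u j.+1 * (n - j.+1).+1%:R * a (n - j.+1).+1.
  rewrite fpsME big_ord_recl subn0 u1 mul1r; congr (_ + _).
  by apply: eq_bigr => j _; rewrite /fpsD mulrA.
have nN0 n : n.+1%:R != 0 :> R by rewrite pnatr_eq0.
split=> -[a1 aE]; split=> //.
  move=> n.
    have := congr1 (@^~ n) aE; rewrite /= LE fpsCM fpsME => <-.
    by rewrite addrK mulKf.
by apply/funext => n; rewrite LE aE mulVKf // fpsCM fpsME subrK.
Qed.

Lemma fps_power_unique u x a b : u 0%N = 1 ->
  is_fps_power u x a -> is_fps_power u x b -> a = b.
Proof.
move=> u1 /(fps_power_recursion _ _ _ u1)[a1 aE] /(fps_power_recursion _ _ _ u1)[b1 bE].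
apply/funext => n; elim/ltn_ind: n => -[|n] IHn; first by rewrite a1 b1.
rewrite aE bE; congr (_ * (_ * _ - _)); apply: eq_bigr => j _; rewrite IHn //.
  by rewrite ltnS leq_subr.
by rewrite ltnS ltn_subrL /= (leq_ltn_trans _ (ltn_ord j)).
Qed.

(** The recursion only multiplies by the exponent and divides by integers, so it can be run in
    [{poly R}] with ['X] as exponent. This gives continuity in the exponent later. *)
Lemma fps_power_poly u : u 0%N = 1 ->
  exists A : nat -> {poly R}, forall x, is_fps_power u x (fun n => (A n).[x]).
Proof.
move=> u1; have [|A AE] := @strong_recursion {poly R} 0 (fun n s =>
  if n is m.+1 then m.+1%:R^-1 *: ('X * \sum_(j < m.+1) fpsD u j *: s (m - j)%N -
     \sum_(j < m) (u j.+1 * (m - j.+1).+1%:R) *: s (m - j.+1).+1) else 1).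
  move=> [|n] s t st //; congr (_ *: (_ * _ - _)); apply: eq_bigr => j _.
    by rewrite st // ltnS leq_subr.
  by rewrite st // ltnS ltn_subrL /= (leq_ltn_trans _ (ltn_ord j)).
exists A => x; apply/fps_power_recursion => //; split; first by rewrite AE hornerC.
move=> n; rewrite AE hornerZ hornerD hornerN hornerM hornerX !horner_sum.
by congr (_ * (_ * _ - _)); apply: eq_bigr => j _; rewrite hornerZ.
Qed.

Lemma fps_powerD u x y a b :
  is_fps_power u x a -> is_fps_power u y b -> is_fps_power u (x + y) (a * b).
Proof.
move=> [a1 aE] [b1 bE]; split; first by rewrite fpsM0 a1 b1 mulr1.
transitivity (u * fpsD a * b + a * (u * fpsD b)); first by (rewrite fpsDM; ring).
by rewrite aE bE fpsCD; ring.
Qed.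

Lemma fps_power0 u : is_fps_power u 0 1.
Proof.
split=> //; apply/funext => n; rewrite fpsCM mul0r -fpsC1 fpsDC mulr0 //.
Qed.

Lemma fps_power1 u : u 0%N = 1 -> is_fps_power u 1 u.
Proof. by split=> //; rewrite fpsC1 mul1r mulrC. Qed.

End FpsPower.

(** * Positive series and their closure properties *)

Section Positivity.
Context {R : realType} {V : lmodType R} (B : V -> V -> R).
Hypothesis BDl : forall u v w, B (u + v) w = B u w + B v w.
Hypothesis BZl : forall c v w, B (c *: v) w = c * B v w.
Hypothesis BC : forall v w, B v w = B w v.
Hypothesis B_ge0 : forall v, 0 <= B v v.
Implicit Types (a b : fps R).

Let BDr (u v w : V) : B w (u + v) = B w u + B w v.
Proof. by rewrite !(BC w) BDl. Qed.
Let BZr c (v w : V) : B w (c *: v) = c * B w v.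
Proof. by rewrite !(BC w) BZl. Qed.
Let B0l (w : V) : B 0 w = 0.
Proof. by rewrite -(scale0r 0) BZl mul0r. Qed.
Let B_suml n (f : 'I_n -> V) (w : V) : B (\sum_i f i) w = \sum_i B (f i) w.
Proof.
elim/big_ind2: _ => [|x y z t <- <-|//]; last exact: BDl.
exact: B0l.
Qed.

Definition toeplitz a (v : nat -> V) N := \sum_(n < N) B (conv a v n) (v n).

Definition positive a := forall v N, 0 <= toeplitz a v N.

(** The form of order N sees only the coefficients below N, so positivity passes to z-adic
    limits. *)
Lemma eq_toeplitz {a b v N} :
  vanishes N (a - b) -> toeplitz a v N = toeplitz b v N.
Proof.
move=> ab; apply: eq_bigr => n _; congr B; apply: eq_conv => j jn.
by apply/eqP; rewrite -subr_eq0; apply/eqP/ab/(leq_ltn_trans jn).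
Qed.

Lemma positiveD a b : positive a -> positive b -> positive (a + b).
Proof.
move=> a0 b0 v N; rewrite /toeplitz.
under eq_bigr do rewrite convDl BDl.
by rewrite big_split addr_ge0 //; [exact: a0|exact: b0].
Qed.

Lemma positiveC c a : 0 <= c -> positive a -> positive (fpsC c * a).
Proof.
move=> c0 a0 v N; rewrite (_ : toeplitz _ _ _ = c * toeplitz a v N).
  by rewrite mulr_ge0 //; exact: a0.
rewrite mulr_sumr; apply: eq_bigr => n _; rewrite -BZl -convZl.
by congr B; apply: eq_conv => j _; rewrite fpsCM.
Qed.

(** Substitute y = w v, so that v = b y: the form of a w at v becomes the sum of the pairings of a y
    with b y. *)
Lemma toeplitz_mul {a b w v N} : b * w = 1 ->
  toeplitz (a * w) v N = \sum_(n < N) B (conv a (conv w v) n) (conv b (conv w v) n).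
Proof. by move=> bw; apply: eq_bigr => n _; rewrite convM -[conv b _ _]convM bw conv1. Qed.

Lemma positive_inv {a b} : a * b = 1 -> positive a -> positive b.
Proof.
move=> ab a0 v N; rewrite -[b]mul1r (toeplitz_mul ab).
by under eq_bigr do rewrite conv1 BC; exact: a0.
Qed.

Definition dilate (r : R) a : fps R := fun n => r ^+ n * a n.

(** Summation by parts: the weighted sum is at least [w N] times the plain sum, by induction on
    [N]. *)
Lemma abel_ge0 (w x : nat -> R) N :
  (forall n, 0 <= w n) -> (forall n, w n.+1 <= w n) ->
  (forall n, 0 <= \sum_(i < n) x i) -> 0 <= \sum_(i < N) w i * x i.
Proof.
move=> w0 wS x0; apply: le_trans (_ : w N * \sum_(i < N) x i <= _).
  by apply: mulr_ge0; [exact: w0|exact: x0].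
elim: N => [|N IHN]; first by rewrite !big_ord0 mulr0.
rewrite [leRHS]big_ord_recr /=; apply: le_trans (_ : w N * \sum_(i < N.+1) x i <= _).
  by apply: ler_wpM2r; [exact: x0|exact: wS].
by rewrite big_ord_recr mulrDr lerD2r.
Qed.

(** With u_n = r^(-n) v_n the n-th term is r^(2n) times that of the form of a at u; these weights
    decrease and the unweighted partial sums are nonnegative. *)
Lemma positive_dilate r a : 0 < r <= 1 -> positive a -> positive (dilate r a).
Proof.
move=> /andP[r0 r1] a0 v N; pose u n := r ^- n *: v n.
have rN0 n : r ^+ n != 0 by rewrite expf_neq0 ?gt_eqF.
have -> : toeplitz (dilate r a) v N =
    \sum_(n < N) (r ^+ 2) ^+ n * B (conv a u n) (u n).
  apply: eq_bigr => n _.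
  have -> : conv (dilate r a) v n = r ^+ n *: conv a u n.
    rewrite scaler_sumr; apply: eq_bigr => j _.
    rewrite !scalerA; congr (_ *: _); rewrite /dilate.
    have -> : r ^+ n = r ^+ j * r ^+ (n - j) by rewrite -exprD subnKC // -ltnS.
    by rewrite mulrAC mulfK.
  rewrite /u BZl BZr -exprM mulnC exprM expr2 !mulrA; congr (_ * _).
  by rewrite mulfK.
apply: (abel_ge0 (fun n => (r ^+ 2) ^+ n) (fun n => B (conv a u n) (u n))) => [n|n|n]; last exact: a0.
  by rewrite exprn_ge0 // exprn_ge0 // ltW.
by rewrite exprS ler_piMl ?exprn_ge0 ?exprn_ile1 // ltW.
Qed.

(* One step of the arithmetic-harmonic mean iteration sends the pair (a, b) to
   (a', s^2 / a') with a' - s = (a - s)^2 / (2 a), so that the order of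
   vanishing of a - s increases. *)
Lemma positive_geometric_mean (a b s : fps R) :
    positive a -> positive b -> a 0%N = 1 -> b 0%N = 1 -> s 0%N = 1 ->
  a * b = s * s -> positive s.
Proof.
move=> a_ge0 b_ge0 a1 b1 s1 ab.
pose h : fps R := fpsC 2^-1; have h2 : h + h = 1.
  by rewrite -fpsCD -fpsC1; congr fpsC; lra.
have main m : exists a b, [/\ positive a /\ positive b, a 0%N = 1 /\ b 0%N = 1,
    a * b = s * s & vanishes m.+1 (a - s)].
  elim: m => [|m [{}a [{}b [[{}a_ge0 {}b_ge0] [{}a1 {}b1] {}ab van]]]].
    exists a, b; split => // -[|//] _; rewrite -[LHS]/(a 0%N - s 0%N).
    by rewrite a1 s1 subrr.
  have [ia aV] := fps_inv a (eq_ind_r (fun x => x != 0) (oner_neq0 R) a1).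
  have [ib bV] := fps_inv b (eq_ind_r (fun x => x != 0) (oner_neq0 R) b1).
  pose a' := h * (a + b).
  have h0 : 0 <= 2^-1 :> R by rewrite invr_ge0.
  have a'1 : a' 0%N = 1.
    rewrite /a' /h fpsCM -[(a + b) 0%N]/(a 0%N + b 0%N) a1 b1; lra.
  have [ia' a'V] := fps_inv a' (eq_ind_r (fun x => x != 0) (oner_neq0 R) a'1).
  (* The new b is the harmonic mean: its inverse is (1/a + 1/b) / 2, which is positive. *)
  have b'V : h * (ia + ib) * (s * s * ia') = 1.
    transitivity (h * (a * ia * b + a * (b * ib)) * ia'); first by (rewrite -ab; ring).
    by rewrite aV bV mul1r mulr1 [b + a]addrC.
  exists a', (s * s * ia'); split.
  - split; first exact/positiveC/positiveD.
    apply: positive_inv b'V _; apply: positiveC h0 _; apply: positiveD.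
      exact: positive_inv aV _.
    exact: positive_inv bV _.
  - split=> //; have := congr1 (@^~ 0%N) a'V.
    by rewrite /= !fpsM0 a'1 s1 !mul1r.
  - by rewrite mulrCA a'V mulr1.
  - have -> : a' - s = (a - s) * (a - s) * (ia * h).
      transitivity (h * ((a * ia) * (a - s - s) + ia * (s * s))); last by ring.
      rewrite -ab mulrA [ia * a]mulrC aV !mul1r -[s in LHS]mul1r -h2 /a'.
      by ring.
    (* The square vanishes to order 2(m+1), which is at least m+2. *)
    rewrite -[m.+2]addn0; apply: vanishesM => //; have := vanishesM van van.
    by move=> vv i im; apply: vv; rewrite (leq_trans im) // addSnnS leq_addl.
move=> v N; have [a' [b' [[a'0 _] _ _ van]]] := main N.
rewrite -(eq_toeplitz (a := a')) => [|i iN]; first exact: a'0.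
by rewrite van // ltnW.
Qed.

(** * Sums of squares for w and delta w *)

Definition fps_seq (s : seq R) : fps R := fun n => s`_n.

(* The coefficients of delta(z) = (1 - z) + (1 - z)^2 / 2 + (1 - z)^3 / 3. *)
Definition bdf3 : fps R := fps_seq [:: 11 / 6; - 3; 3 / 2; - 3^-1].
Definition denominator : fps R := fps_seq [:: 1; - 2^-1].

(* [pad v n] is the term of index n - 3 of v extended by zero. *)
Let pad (v : nat -> V) n : V := if n is m.+3 then v m else 0.

Let fps_seq_shift x s : (fun j => fps_seq (x :: s) j.+1 : R) = fps_seq s.
Proof. by []. Qed.
Let fps_seq0 x s : fps_seq (x :: s) 0%N = x.
Proof. by []. Qed.
Let conv_seq1 x (v : nat -> V) n : conv (fps_seq [:: x]) v n = x *: v n.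
Proof.
rewrite /conv big_ord_recl subn0 big1 ?addr0 // => j _.
by rewrite /fps_seq /= nth_nil scale0r.
Qed.

Lemma conv_bdf3 (v : nat -> V) n : conv bdf3 v n =
  (11 / 6) *: pad v n.+3 - 3 *: pad v n.+2 + (3 / 2) *: pad v n.+1 - 3^-1 *: pad v n.
Proof.
rewrite /bdf3; case: n => [|[|[|n]]];
rewrite !(conv_seq1, conv0, convS, fps_seq_shift, fps_seq0) /=;
by rewrite ?scaler0 ?subr0 ?addr0 ?scaleNr ?addrA.
Qed.

Lemma conv_denominator (v : nat -> V) n :
  conv denominator v n = pad v n.+3 - 2^-1 *: pad v n.+2.
Proof.
rewrite /denominator; case: n => [|n];
rewrite !(conv_seq1, conv0, convS, fps_seq_shift, fps_seq0) /=;
by rewrite ?scaler0 ?subr0 ?addr0 ?scaleNr ?scale1r.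
Qed.

Let BE := (BDl, BDr, BZl, BZr).
Let BNl (v w : V) : B (- v) w = - B v w.
Proof. by rewrite -scaleN1r BZl mulN1r. Qed.
Let BNr (v w : V) : B w (- v) = - B w v.
Proof. by rewrite !(BC w) BNl. Qed.

(** With x the new vector and y the previous one, |x|^2 - (x,y)/2 + |y|^2/4 - |x|^2/4 = |x-y|^2/4 +
    |x|^2/2, so a quarter of the last squared norm is carried along the induction. *)
Lemma positive_denominator : positive denominator.
Proof.
move=> v N; suff: 4^-1 * B (pad v N.+2) (pad v N.+2) <= toeplitz denominator v N.
  by apply: le_trans; rewrite mulr_ge0.
elim: N => [|N IHN].
  by rewrite /toeplitz big_ord0 /= B0l mulr0.
rewrite /toeplitz big_ord_recr /= -/(toeplitz _ _ _) conv_denominator.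
rewrite -[v N]/(pad v N.+3); move: (pad v N.+3) (pad v N.+2) IHN => x y IHN.
have := B_ge0 (x - y); have := B_ge0 x.
rewrite !(BE, BNl, BNr) (BC y x); lra.
Qed.

Let energy x y z :=
  29 / 4 * B x x - 13 * B x y + 29 / 4 * B y y + 4 * B x z - 5 * B y z + B z z.

Let energy_ge0 x y z : 0 <= energy x y z.
Proof.
(* Complete the square in x, then in y. *)
have -> : energy x y z =
    29 / 4 * B (x - (26 / 29) *: y + (8 / 29) *: z) (x - (26 / 29) *: y + (8 / 29) *: z)
    + 165 / 116 * B (y - (82 / 165) *: z) (y - (82 / 165) *: z) + 16 / 165 * B z z.
  rewrite /energy !(BE, BNl, BNr) (BC y x) (BC z x) (BC z y).
  by field.
by rewrite !addr_ge0 // mulr_ge0.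
Qed.

(* With c = cos t, 6 Re (delta (1 - zbar / 2)) at z = exp(it) is
   (1 - c) (10 - 12 c + 8 c^2)
   = |(1 - z) (1 - 3/2 z + z^2)|^2 + 11/4 |1 - z|^2; the energy is the boundary
   term left by this identity on truncated sums. *)
Lemma positive_bdf3 w : denominator * w = 1 -> positive (bdf3 * w).
Proof.
move=> dw v N; rewrite (toeplitz_mul dw); move: (conv w v) => y.
have step n : energy (pad y n.+3) (pad y n.+2) (pad y n.+1) <=
    energy (pad y n.+2) (pad y n.+1) (pad y n) +
    6 * B (conv bdf3 y n) (conv denominator y n).
  rewrite conv_bdf3 conv_denominator.
  move: (pad y n.+3) (pad y n.+2) (pad y n.+1) (pad y n) => a b c d.
  have := B_ge0 (a - b).
  (* The coefficients are those of (1 - z) (1 - 3/2 z + z^2). *)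
  have := B_ge0 (a - (5 / 2) *: b + (5 / 2) *: c - d).
  rewrite /energy !(BE, BNl, BNr) (BC b a) (BC c a) (BC d a) (BC c b) (BC d b) (BC d c).
  lra.
rewrite -(pmulr_rge0 _ (ltr0n R 6)).
apply: le_trans (energy_ge0 (pad y N.+2) (pad y N.+1) (pad y N)) _.
elim: N => [|N IHN].
  by rewrite /energy /= !B0l big_ord0; lra.
by rewrite big_ord_recr mulrDr; apply: le_trans (step N) _; rewrite lerD2r.
Qed.

(** * Interpolation between the exponents 0 and 1 *)

Section PositivePower.
Variables (u w : fps R).
Hypotheses (u1 : u 0%N = 1) (w1 : w 0%N = 1).
Hypotheses (w_ge0 : positive w) (uw_ge0 : positive (u * w)).

Let good (x : R) := forall a, is_fps_power u x a -> positive (a * w).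

Let good0 : good 0.
Proof. by move=> a aP; rewrite (fps_power_unique _ _ _ _ u1 aP (fps_power0 u)) mul1r. Qed.

Let good1 : good 1.
Proof. by move=> a aP; rewrite (fps_power_unique _ _ _ _ u1 aP (fps_power1 u u1)). Qed.

(** The product of u^x w and u^y w is the square of u^((x+y)/2) w, so the latter is their geometric
    mean. *)
Let good_mid x y : good x -> good y -> good ((x + y) / 2).
Proof.
move=> gx gy s sP; have [A AP] := fps_power_poly u u1.
have /gx ax := AP x; have /gy ay := AP y.
apply: positive_geometric_mean ax ay _ _ _ _; rewrite ?fpsM0 ?w1 ?mulr1.
- by have [] := AP x.
- by have [] := AP y.
- by have [] := sP.
rewrite mulrACA [RHS]mulrACA; congr (_ * _).
apply: (fps_power_unique _ _ _ _ u1 (fps_powerD _ _ _ _ _ (AP x) (AP y))).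
by have := fps_powerD _ _ _ _ _ sP sP; rewrite -splitr.
Qed.

(** Bisection from [0, 1]: the midpoint, good by [good_mid], replaces one endpoint. *)
Let good_dense x k : 0 <= x <= 1 ->
  exists y z, [/\ y <= x <= z, z - y = 1 / 2 ^+ k, good y & good z].
Proof.
move=> x01; elim: k => [|k [y [z [/andP[yx xz] zy gy gz]]]].
  by exists 0, 1; rewrite subr0 expr0 divr1.
have h : 1 / 2 ^+ k.+1 = (1 / 2 ^+ k) / 2 :> R.
  by rewrite exprSr invfM !mul1r.
have [xm|mx] := lerP x ((y + z) / 2).
  exists y, ((y + z) / 2); rewrite yx xm h -zy; split=> //; last exact: good_mid.
  by field.
exists ((y + z) / 2), z; rewrite xz ltW // h -zy; split=> //; last exact: good_mid.
by field.
Qed.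

Lemma positive_power x a : 0 <= x <= 1 -> is_fps_power u x a -> positive (a * w).
Proof.
move=> x01 aP v N; have [A AP] := fps_power_poly u u1.
(* For fixed [v] and [N] the form is a polynomial in the exponent. If negative at [x], it would be
   negative nearby, hence at some good exponent. *)
pose p := \sum_(n < N) \sum_(j < n.+1) B (conv w v (n - j)%N) (v n) *: A j.
have pE y : toeplitz (((fun n => (A n).[y]) : fps R) * w) v N = p.[y].
  rewrite horner_sum; apply: eq_bigr => n _; rewrite convM horner_sum B_suml.
  by apply: eq_bigr => j _; rewrite BZl hornerZ mulrC.
rewrite (fps_power_unique _ _ _ _ u1 aP (AP x)) pE leNgt; apply/negP => px0.
have /nbhs_ballP[e /= e0 pe] : \forall y \near x, p.[y] < 0.
  have px : (p.[y] @[y --> x] --> p.[x])%classic by exact: continuous_horner.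
  exact: (cvgr_lt _ px).
have [k _ /(_ k (leqnn k)) /= ke] := near_infty_natSinv_expn_lt (PosNum e0).
have [y [z [/andP[yx xz] zy gy _]]] := good_dense x k x01.
have : p.[y] < 0.
  apply: pe; rewrite /ball /= ger0_norm ?subr_ge0 //.
  by rewrite (le_lt_trans _ ke) // -zy lerB.
by rewrite -pE ltNge (gy _ (AP y)).
Qed.

End PositivePower.

End Positivity.

(** * From convergent real power series to formal identities *)

Section PowerSeries.
Local Open Scope classical_set_scope.
Context {R : realType}.
Implicit Types (a b c : fps R) (f : R -> R) (x : R) (p : {poly R}).

(** The quantity (n+1) s^n (1-s) + s^(n+1) is 1 at n = 0 and drops by (n+1) s^n (1-s)^2 at each
    step. *)
Lemma natS_expr_bound (s : R) n : 0 <= s <= 1 ->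
  n.+1%:R * s ^+ n * (1 - s) <= 1.
Proof.
move=> /andP[s0 s1].
suff: n.+1%:R * s ^+ n * (1 - s) + s ^+ n.+1 <= 1.
  by apply: le_trans; rewrite lerDl exprn_ge0.
elim: n => [|n IHn]; first by rewrite expr0 expr1 !mul1r subrK.
apply: le_trans IHn; rewrite -subr_ge0.
have -> : n.+1%:R * s ^+ n * (1 - s) + s ^+ n.+1 -
    (n.+2%:R * s ^+ n.+1 * (1 - s) + s ^+ n.+2) =
    n.+1%:R * s ^+ n * ((1 - s) * (1 - s)).
  by rewrite !exprS -[n.+2]addn1 natrD; ring.
by rewrite !mulr_ge0 ?exprn_ge0 // subr_ge0.
Qed.

Lemma is_cvg_pseries_fpsD c (K x : R) :
  cvgn (pseries c K) -> `|x| < `|K| -> cvgn (pseries (fpsD c) x).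
Proof.
move=> cK xK; have K0 : 0 < `|K| := le_lt_trans (normr_ge0 x) xK.
have [M [_ Mc]] := cvg_series_bounded cK.
have {}Mc n : `|c n * K ^+ n| <= `|M| + 1.
  by apply: Mc => //; rewrite (le_lt_trans (ler_norm M)) // ltrDl.
pose q := `|x| / `|K|; pose s := Num.sqrt q.
have q0 : 0 <= q by rewrite divr_ge0.
have s1 : s < 1 by rewrite -sqrtr1 ltr_sqrt // ltr_pdivrMr // mul1r.
have s0 : 0 <= s := sqrtr_ge0 q.
have s1N : 0 < 1 - s by rewrite subr_gt0.
apply: normed_cvg; pose C := (`|M| + 1) / (`|K| * (1 - s)).
apply: (@series_le_cvg _ _ (geometric C s)) => [n|n|n|].
- exact: normr_ge0.
- by rewrite /geometric /= mulr_ge0 ?exprn_ge0 // divr_ge0 ?addr_ge0 // mulr_ge0 // ltW.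
- have xE : `|x| ^+ n = s ^+ n * s ^+ n * `|K| ^+ n.
    by rewrite -exprMn -exprMn -expr2 sqr_sqrtr // divfK // gt_eqF.
  rewrite /fpsD /= !normrM normr_nat normrX xE /C.
  have -> : n.+1%:R * `|c n.+1| * (s ^+ n * s ^+ n * `|K| ^+ n) =
      `|c n.+1 * K ^+ n.+1| * (n.+1%:R * s ^+ n * (1 - s)) / (`|K| * (1 - s)) * s ^+ n.
    rewrite normrM normrX exprS; field.
    by rewrite !gt_eqF.
  rewrite /geometric /=; apply: ler_wpM2r; first exact: exprn_ge0.
  apply: ler_wpM2r; first by rewrite invr_ge0 mulr_ge0 // ltW.
  rewrite -[leRHS]mulr1; apply: ler_pM; rewrite ?Mc //.
    by rewrite !mulr_ge0 ?exprn_ge0 // ltW.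
  by rewrite natS_expr_bound // s0 ltW.
- by apply: is_cvg_geometric_series; rewrite ger0_norm.
Qed.

Lemma has_pseries_derive f c : has_pseries_at0 f c ->
  \forall x \near (0 : R), exists2 l : R,
    is_derive (x : R) (1 : R) f l & pseries (fpsD c) x @ \oo --> l.
Proof.
move=> /nbhs_ballP[e /= e0 fc]; apply/nbhs_ballP.
have e4 : 0 < e / 4 by rewrite divr_gt0.
have be x : `|x| < e -> pseries c x @ \oo --> f x.
  by move=> xe; apply: fc; rewrite /ball /= sub0r normrN.
have ke k : 0 <= k < 1 -> `|e * k| < e.
  move=> /andP[k0 k1]; have ek : 0 <= e * k by rewrite mulr_ge0 // ltW.
  by rewrite (ger0_norm ek) gtr_pMr.
have kl k l : 0 <= k < l -> `|e * k| < `|e * l|.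
  move=> /andP[k0 kl]; have l0 := le_trans k0 (ltW kl).
  by rewrite !normrM (gtr0_norm e0) !ger0_norm // ltr_pM2l.
(* Termwise differentiation is applied with the series and its first two derivatives converging at
   e/4; each derivative costs some radius, whence 3e/4, e/2, e/4. *)
have c1 : cvgn (pseries c (e * (3 / 4))).
  by apply/cvg_ex; exists (f (e * (3 / 4))); apply/be/ke; lra.
have c2 : cvgn (pseries (fpsD c) (e * (1 / 2))).
  by apply: is_cvg_pseries_fpsD c1 _; apply: kl; lra.
have c3 : cvgn (pseries (fpsD (fpsD c)) (e * (1 / 4))).
  by apply: is_cvg_pseries_fpsD c2 _; apply: kl; lra.
have c2' : cvgn (pseries (fpsD c) (e * (1 / 4))).
  by apply: is_cvg_pseries_inside c2 _; apply: kl; lra.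
have c1' : cvgn (pseries c (e * (1 / 4))).
  by apply: is_cvg_pseries_inside c1 _; apply: kl; lra.
exists (e / 4) => //= x; rewrite /ball /= sub0r normrN => xe.
have xK : `|x| < `|e * (1 / 4)|.
  by rewrite mul1r [ltRHS]gtr0_norm.
exists (limn (pseries (fpsD c) x)); last exact: is_cvg_pseries_inside c2' xK.
(* [f] is known to equal the sum only on the ball of radius e, which contains the ball of radius e/4
   around [x]. *)
apply: near_eq_is_derive (pseries_snd_diffs c1' c2' c3 xK).
apply/nbhs_ballP; exists (e / 4) => //= y; rewrite /ball /= => xy.
apply/cvg_lim => //; apply: be.
rewrite -[y](subKr x) (le_lt_trans (ler_normB _ _)) //.
by apply: lt_trans (ltrD xe xy) _; lra.
Qed.

Lemma has_pseries_coef0 f c : has_pseries_at0 f c -> c 0%N = f 0.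
Proof.
move=> /nbhs_singleton f0; apply: (@cvg_unique _ _ (pseries c 0 @ \oo)) => //.
apply: cvg_near_cst; exists 1%N => // -[//|n] _.
rewrite /pseries /series /= big_nat_recl // expr0 mulr1 big1 ?addr0 //.
by move=> i _; rewrite exprS mul0r mulr0.
Qed.

(** The constant term is the value at 0, and the derived series again sums to 0; its n-th
    coefficient is (n+1) c_(n+1). *)
Lemma has_pseries_eq0 c : has_pseries_at0 (fun=> 0) c -> c = 0.
Proof.
move=> c0; apply/funext => n; rewrite -[RHS]/(0 : R).
elim: n c c0 => [|n IHn] c c0; first exact: has_pseries_coef0 c0.
suff /IHn/eqP : has_pseries_at0 (fun=> 0) (fpsD c).
  by rewrite /fpsD mulf_eq0 pnatr_eq0 => /eqP.
move: (has_pseries_derive _ _ c0); apply: filterS => x [l dl].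
by rewrite -(@derive_val _ _ _ _ _ _ _ dl) derive_cst.
Qed.

Lemma cvg_pseriesD a b x (l m : R) : pseries a x @ \oo --> l ->
  pseries b x @ \oo --> m -> pseries (a + b : fps R) x @ \oo --> l + m.
Proof.
move=> al bm.
rewrite (_ : pseries _ x = pseries a x \+ pseries b x); first exact: cvgD.
apply/funext => n; rewrite /pseries /series /= -big_split /=.
by apply: eq_bigr => i _; rewrite -mulrDl.
Qed.

Lemma cvg_pseriesC (k : R) a x (l : R) : pseries a x @ \oo --> l ->
  pseries (fpsC k * a) x @ \oo --> k * l.
Proof.
move=> al.
rewrite (_ : pseries _ x = fun n => k * pseries a x n); first exact: cvgMr.
apply/funext => n; rewrite /pseries /series /= mulr_sumr.
by apply: eq_bigr => i _; rewrite fpsCM mulrA.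
Qed.

Lemma cvg_pseries_shift a x (l : R) : pseries a x @ \oo --> l ->
  pseries (fun n => if n is m.+1 then a m else 0) x @ \oo --> x * l.
Proof.
move=> al; rewrite -cvg_shiftS.
rewrite (_ : (fun n => _) = fun n => x * pseries a x n); first exact: cvgMr.
apply/funext => n.
rewrite /pseries /series /= big_nat_recl // mul0r add0r mulr_sumr.
by apply: eq_bigr => i _; rewrite exprS mulrCA.
Qed.

Definition fps_poly p : fps R := fun n => p`_n.

Lemma fpsD_poly p : fpsD (fps_poly p) = fps_poly p^`().
Proof. by apply/funext => n; rewrite /fps_poly coef_deriv /fpsD mulr_natl. Qed.

(** Horner's scheme in [p], from shifts and constant multiples. *)
Lemma cvg_pseries_polyM p a x (l : R) : pseries a x @ \oo --> l ->
  pseries (fps_poly p * a) x @ \oo --> p.[x] * l.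
Proof.
move=> al; elim/poly_ind: p => [|p k IHp].
  rewrite horner0 mul0r (_ : fps_poly 0 = fpsC 0).
    by have := cvg_pseriesC 0 _ _ _ al; rewrite mul0r.
  by apply/funext => n; rewrite /fps_poly /fpsC coef0 mul0r.
have -> : (p * 'X + k%:P).[x] * l = x * (p.[x] * l) + k * l.
  by rewrite hornerMXaddC mulrDl mulrA [x * _]mulrC.
have -> : fps_poly (p * 'X + k%:P) * a =
    ((fun n => if n is m.+1 then (fps_poly p * a) m else 0) : fps R) + fpsC k * a.
  apply/funext => -[|n]; rewrite -[RHS]/(_ + (fpsC k * a) _) fpsCM.
    by rewrite fpsM0 /fps_poly coefD coefMX coefC /= !add0r.
  rewrite [LHS]fps_mulS /fps_poly coefD coefMX coefC /= add0r addrC.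
  congr (_ + _); apply: eq_bigr => j _.
  by rewrite coefD coefMX coefC /= addr0.
by apply: cvg_pseriesD; [exact: cvg_pseries_shift|exact: cvg_pseriesC].
Qed.

(** Near 0 the function f = p^x satisfies p f' = x p' f. By uniqueness of coefficients this is a
    formal identity, and dividing by the constant terms normalises it. *)
Lemma has_pseries_powR p (x : R) (g : R ^nat) : 0 < p`_0 ->
  has_pseries_at0 (fun y => p.[y] `^ x) g ->
  g 0%N = p`_0 `^ x /\
  is_fps_power (fpsC (p`_0)^-1 * fps_poly p) x (fpsC (g 0%N)^-1 * (g : fps R)).
Proof.
move=> p0 gp; have g0 : g 0%N = p`_0 `^ x.
  by rewrite (has_pseries_coef0 _ _ gp) horner_coef0.
split=> //.
have key : fps_poly p * fpsD g = fpsC x * (fps_poly p^`() * (g : fps R)).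
  apply/eqP; rewrite -subr_eq0; apply/eqP/has_pseries_eq0.
  have pp : \forall y \near (0 : R), 0 < p.[y].
    have pc : p.[y] @[y --> (0 : R)] --> p.[0] by exact: continuous_horner.
    by apply: (cvgr_gt _ pc); rewrite horner_coef0.
  near=> y.
  have py : 0 < p.[y] by near: y.
  have gy : pseries g y @ \oo --> p.[y] `^ x by near: y.
  have [l dl gl] : exists2 l : R, is_derive y (1 : R) (fun y => p.[y] `^ x) l &
      pseries (fpsD g) y @ \oo --> l by near: y; exact: has_pseries_derive.
  have lE : l = x * p.[y] `^ (x - 1) * p^`().[y].
    rewrite -(@derive_val _ _ _ _ _ _ _ dl).
    have := is_derive1_comp (is_derive1_powR x py) (is_derive_poly p y).
    by move=> h; rewrite (@derive_val _ _ _ _ _ _ _ h).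
  have -> : 0 = p.[y] * l + (-1) * (x * (p^`().[y] * p.[y] `^ x)) :> R.
    have -> : p.[y] `^ x = p.[y] `^ (x - 1) * p.[y].
      rewrite -{1}[x](subrK 1) [LHS]powRD; last by apply/implyP => _; rewrite gt_eqF.
      by rewrite powRr1 // ltW.
    by rewrite lE; ring.
  have -> : fps_poly p * fpsD g - fpsC x * (fps_poly p^`() * (g : fps R)) =
      fps_poly p * fpsD g + fpsC (-1) * (fpsC x * (fps_poly p^`() * (g : fps R))).
    congr (_ + _); apply/funext => n; rewrite fpsCM mulN1r //.
  apply: cvg_pseriesD; first exact: cvg_pseries_polyM.
  by do 2 apply: cvg_pseriesC; exact: cvg_pseries_polyM.
split; first by rewrite fpsCM mulVf // g0 gt_eqF // powR_gt0.
rewrite !fpsDM !fpsDC !mul0r !add0r fpsD_poly.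
transitivity (fpsC (p`_0)^-1 * fpsC (g 0%N)^-1 * (fps_poly p * fpsD g)); first by ring.
by rewrite key; ring.
Unshelve. all: by end_near. Qed.

End PowerSeries.

(** * Positivity of the series of the q_j *)

Section Dilate.
Context {R : realType}.
Implicit Types (a b : fps R) (r : R).

Lemma dilateM r a b : dilate r (a * b) = dilate r a * dilate r b.
Proof.
apply/funext => n; rewrite /dilate !fpsME mulr_sumr; apply: eq_bigr => j _.
have -> : r ^+ n = r ^+ j * r ^+ (n - j) by rewrite -exprD subnKC // -ltnS.
by rewrite mulrACA.
Qed.

(** The series of w = 1 / (1 - z/2). *)
Definition geometric_half : fps R := fun n => (2 ^+ n)^-1.

Lemma denominatorM : denominator * geometric_half = 1.
Proof.
apply/funext => -[|n].
  by rewrite fpsM0 /denominator /fps_seq /geometric_half expr0 invr1 mulr1.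
rewrite [LHS]fps_mulS (_ : (fun j => denominator j.+1) = fpsC (- 2^-1)).
  rewrite [fps_mul _ _ n]fpsCM /denominator /fps_seq /geometric_half /=.
  by rewrite -[RHS]/(0 : R) exprS invfM; ring.
by apply/funext => -[|j]; rewrite /fpsC ?mulr1 // mulr0 /denominator /fps_seq /= nth_nil.
Qed.

Lemma qcoefE sigma tau (g : R ^nat) :
  qcoef sigma tau g =
  dilate (expR (- (sigma * tau))) geometric_half * (g : fps R) :> fps R.
Proof.
apply/funext => n; rewrite /qcoef big_mkord; apply: eq_bigr => m _.
rewrite /dilate /geometric_half [(2 ^+ m)^-1 * _]mulrC -expRM_natl.
by congr (expR _ * _ * _); ring.
Qed.

(** The polynomial delta(r z). *)
Definition bdf3_poly r : {poly R} :=
  Poly [:: 11 / 6; - 3 * r; 3 / 2 * r ^+ 2; - 3^-1 * r ^+ 3].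

Lemma fps_poly_bdf3 r : fps_poly (bdf3_poly r) = dilate r bdf3.
Proof.
apply/funext => n; rewrite /fps_poly /bdf3_poly coef_Poly /dilate /bdf3 /fps_seq.
by case: n => [|[|[|[|n]]]] /=; rewrite ?expr0 ?expr1 ?mul1r ?nth_nil ?mulr0 // mulrC.
Qed.

Lemma gfun3E (alpha sigma tau : R) :
  gfun 3 alpha sigma tau =
  fun x => (bdf3_poly (expR (- (sigma * tau)))).[x] `^ alpha.
Proof.
apply/funext => x; rewrite /gfun /bdf3_poly horner_Poly /=; congr (_ `^ _).
by rewrite big_nat_recl // big_nat_recl // big_nat_recl // big_geq //; field.
Qed.

Lemma positive_qcoef {V : lmodType R} (B : V -> V -> R) (alpha sigma tau : R)
    (g : R ^nat) :
  (forall u v w, B (u + v) w = B u w + B v w) ->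
  (forall c v w, B (c *: v) w = c * B v w) ->
  (forall v w, B v w = B w v) -> (forall v, 0 <= B v v) ->
  0 < alpha < 1 -> 0 <= sigma -> 0 < tau ->
  has_pseries_at0 (gfun 3 alpha sigma tau) g ->
  positive B (qcoef sigma tau g).
Proof.
move=> BDl BZl BC B_ge0 /andP[a0 a1] s0 t0; rewrite gfun3E qcoefE.
set r := expR _; have r01 : 0 < r <= 1.
  by rewrite expR_gt0 -expR0 ler_expR oppr_le0 mulr_ge0 // ltW.
have p0 : (bdf3_poly r)`_0 = 11 / 6 by rewrite coef_Poly.
have p0_gt0 : 0 < (bdf3_poly r)`_0 by rewrite p0 divr_gt0.
move=> /(has_pseries_powR _ _ _ p0_gt0)[g0].
set u := fpsC _ * fps_poly _; set a := fpsC _ * _ => au.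
have g0_gt0 : 0 < g 0%N by rewrite g0 powR_gt0.
have u1 : u 0%N = 1 by rewrite /u fpsCM mulVf // gt_eqF.
(* The factor [g 0] is positive, and [a] is the normalised power u^alpha with u = delta(r z) /
   delta(0). *)
have -> : dilate r geometric_half * (g : fps R) =
    fpsC (g 0%N) * (a * dilate r geometric_half).
  rewrite [RHS](_ : _ = fpsC (g 0%N) * fpsC (g 0%N)^-1 *
    (dilate r geometric_half * (g : fps R))); last by rewrite /a; ring.
  by rewrite -fpsC_mul divff ?gt_eqF // fpsC1 mul1r.
apply: positiveC => //; first exact: ltW.
have half_ge0 : positive B geometric_half.
  apply: positive_inv denominatorM _ => //; exact: positive_denominator.
apply: positive_power au => //.
- by rewrite /dilate /geometric_half expr0 mul1r expr0 invr1.
- exact: positive_dilate.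
(* Dilation is multiplicative, so u times the dilated w is a positive multiple of the dilation of
   delta w. *)
- rewrite /u fps_poly_bdf3 -mulrA -dilateM; apply: positiveC => //.
    by rewrite invr_ge0 ltW.
  by apply: positive_dilate => //; apply: positive_bdf3 denominatorM.
- by rewrite !ltW.
Qed.

End Dilate.

(** * Restriction of scalars to the reals, and the two Hilbert space cases *)

Definition realification (R : realType) (V : lmodType R[i]) : Type := V.
HB.instance Definition _ (R : realType) (V : lmodType R[i]) :=
  GRing.Zmodule.on (realification R V).

Section Realification.
Context {R : realType} {V : lmodType R[i]}.

Definition real_scale (c : R) (v : realification R V) : realification R V :=
  (c%:C *: (v : V)).

Fact real_scaleA c d v : real_scale c (real_scale d v) = real_scale (c * d) v.
Proof. by rewrite /real_scale scalerA rmorphM. Qed.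
Fact real_scale1 : left_id 1 real_scale.
Proof. by move=> v; rewrite /real_scale rmorph1 scale1r. Qed.
Fact real_scaleDr : right_distributive real_scale +%R.
Proof. by move=> c v w; rewrite /real_scale scalerDr. Qed.
Fact real_scaleDl v : {morph real_scale^~ v : c d / c + d}.
Proof. by move=> c d; rewrite /real_scale rmorphD scalerDl. Qed.

HB.instance Definition _ := GRing.Zmodule_isLmodule.Build R (realification R V)
  real_scaleA real_scale1 real_scaleDr real_scaleDl.
End Realification.

(** Shifts the index by one: Toeplitz forms start at index 0, the vectors of the theorem at 1. *)
Lemma toeplitzE {R : realType} {V : lmodType R} (B : V -> V -> R) (q : fps R)
    (v : nat -> V) N :
  toeplitz B q (fun n => v n.+1) N =
  \sum_(1 <= n < N.+1) B (\sum_(0 <= j < n) q j *: v (n - j)%N) (v n).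
Proof.
rewrite big_add1 big_mkord; apply: eq_bigr => n _; congr B.
by rewrite big_mkord; apply: eq_bigr => j _; rewrite subSn // -ltnS.
Qed.

Lemma ReMl (R : realType) (c : R) (z : R[i]) :
  complex.Re (c%:C * z) = c * complex.Re z.
Proof. by case: z => x y; rewrite /= mul0r subr0. Qed.

Lemma ReJ (R : realType) (z : R[i]) : complex.Re (Num.conj z) = complex.Re z.
Proof. by case: z. Qed.

Theorem lemma3p5 (R : realType) (alpha sigma tau : R) (g : nat -> R)
    (halpha : 0 < alpha < 1) (hsigma : 0 <= sigma) (htau : 0 < tau)
    (hg : has_pseries_at0 (gfun 3 alpha sigma tau) g) :
  (forall (H : completeNormedModType R) (dot : {dot H for idfun}),
     induces_norm dot ->
     forall (N : nat) (v : nat -> H), (0 < N)%N ->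
     0 <= \sum_(1 <= n < N.+1)
            dot (\sum_(0 <= j < n) qcoef sigma tau g j *: v (n - j)%N) (v n))
  /\
  (forall (H : completeNormedModType R[i])
     (dot : {dot H for @Num.conj (R[i])}),
     induces_norm dot ->
     forall (N : nat) (v : nat -> H), (0 < N)%N ->
     0 <= complex.Re (\sum_(1 <= n < N.+1)
            dot (\sum_(0 <= j < n)
                   (qcoef sigma tau g j)%:C *: v (n - j)%N) (v n))).
Proof.
split=> H dot dotE N v _.
  rewrite -(toeplitzE dot); apply: positive_qcoef hg _ _ => //.
  - by move=> x y z; rewrite linearDl.
  - by move=> c x y; rewrite linearZl_LR.
  - by move=> x y; rewrite hermC expr0 mul1r.
  - by move=> x; rewrite dotE exprn_ge0.
(* The real part of the Hermitian form is a symmetric real bilinear form on the underlying real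
   space. *)
pose B (x y : realification R H) : R := complex.Re (dot x y).
rewrite raddf_sum -(toeplitzE B); apply: positive_qcoef hg _ _ => //.
- by move=> x y z; rewrite /B linearDl raddfD.
- by move=> c x y; rewrite /B linearZl_LR; exact: ReMl.
- by move=> x y; rewrite /B hermC expr0 mul1r; exact: ReJ.
- by move=> x; rewrite /B dotE; have : 0 <= `|x : H| ^+ 2 by [exact: exprn_ge0]; rewrite lecE => /andP[].
Qed.
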